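(* Let $p_h\in V_h^1$ be the solution of the enriched Petrov-Galerkin method $a(p_h,q_h)=l(q_h)$ for all $q_h\in V_h^2$, and let $u_h$ be the velocity recovered from $p_h$ (as defined in the context). Then $u_h$ is locally mass-conservative: $$\int_{\partial T}u_h\cdot n\,d\sigma=\int_T f\,dx\qquad\text{for all } T\in\mathcal{T}_h,$$ where $n$ is the unit outward normal on $\partial T$.
   Context: Let $\Omega\subset\mathbb{R}^d$ ($d=2$ or $3$) be a bounded polygonal/polyhedral domain, $\partial\Omega=\Gamma_D\cup\Gamma_N$ with $\Gamma_D\cap\Gamma_N=\emptyset$. The Darcy problem is $-\nabla\cdot(K\nabla p)=f$ in $\Omega$, $p=p_D$ on $\Gamma_D$, $-K\nabla p\cdot n=g_N$ on $\Gamma_N$. Let $\mathcal{T}_h$ be a conforming partition of $\Omega$ into triangles ($d=2$) or tetrahedra ($d=3$). $K$ is a positive scalar function, constant on each mesh element, bounded above and below by positive constants. Faces/edges: $\Gamma_h$, $\Gamma_{h,D}$, $\Gamma_{h,N}$ are the sets of faces ($d=3$) or edges ($d=2$) of $\mathcal{T}_h$ that are interior, on $\Gamma_D$, on $\Gamma_N$, respectively. Each $e$ carries a fixed unit normal $n_e$ (outward to $\Omega$ on boundary faces). For $e\subset\partial T_i\cap\partial T_j$ with $n_e$ exterior to $T_i$, $\{v\}=\frac12(v|_{T_i}+v|_{T_j})$ and $[v]=v|_{T_i}-v|_{T_j}$; on Dirichlet faces $\{v\}=[v]=v$. Spaces: for an integer $k\ge1$, $M_0^k(\mathcal{T}_h)$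 is the space of continuous functions that are polynomials of degree at most $k$ on each $T\in\mathcal{T}_h$, and $M^0(\mathcal{T}_h)$ is the space of piecewise constants. $M^b(\mathcal{T}_h)=\{\sum_{T}\alpha_T b_T:\alpha_T\in\mathbb{R}\}$, where the local bubble $b_T$ (extended by zero outside $T$) is defined as follows. Let $\lambda_1,\dots,\lambda_{d+1}$ be the barycentric coordinates of $T$, $e_i$ the face of $T$ on which $\lambda_i=0$, $n_i$ its outward unit normal, and $b_{T,i}=\beta_i\,\lambda_1^2\cdots\lambda_{d+1}^2/\lambda_i$ with $\beta_i$ determined by $\int_{e_i}\beta_i K\nabla\lambda_i\cdot n_i\,\frac{\lambda_1^2\cdots\lambda_{d+1}^2}{\lambda_i^2}\,d\sigma=1$. For $k=1$, $b_T=\sum_{i=1}^{d+1}b_{T,i}$. For $k\ge2$, $b_T=\sum_{i=1}^{d+1}b_{T,i}+\sum_{j=1}^J\gamma_j\lambda_1^2\cdots\lambda_{d+1}^2\psi_j$, where $J=\binom{k+d-2}{d}$, $\{\psi_j\}_{j=1}^J$ is a basis of $\mathbb{P}_{k-2}(T)$, and the $\gamma_j$ are the unique coefficients such that $\int_T K b_T\psi_i\,dx=0$ for $i=1,\dots,J$. The trial and test spaces are $V_h^1=M_0^k(\mathcal{T}_h)+M^b(\mathcal{T}_h)$ and $V_h^2=M_0^k(\mathcal{T}_h)+M^0(\mathcal{T}_h)$. Forms: $$a(p,q)=\sum_{T\in\mathcal{T}_h}\int_T K\nabla p\cdot\nabla q\,dx-\sum_{e\in\Gamma_h\cup\Gamma_{h,D}}\int_e\{K\nabla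 p\cdot n_e\}[q]\,d\sigma-\sum_{e\in\Gamma_h\cup\Gamma_{h,D}}\int_e\{K\nabla q\cdot n_e\}[p]\,d\sigma,$$ $$l(q)=\sum_{T\in\mathcal{T}_h}\int_T fq\,dx-\sum_{e\in\Gamma_{h,N}}\int_e g_Nq\,d\sigma-\sum_{e\in\Gamma_{h,D}}\int_e K\nabla q\cdot n_e\,p_D\,d\sigma .$$ Recovered velocity: $u_h=-K\nabla p_h$ in the interior of each $T\in\mathcal{T}_h$; its normal component on faces is defined by $u_h\cdot n=g_N$ on $\Gamma_{h,N}$, $u_h\cdot n=-\{K\nabla p_h\cdot n\}$ on $\Gamma_h$, and $u_h\cdot n=-K\nabla p_h\cdot n$ on $\Gamma_{h,D}$. Integrals over $\partial T$ of $u_h\cdot n$ use these face values. *)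

(* Defs.v *)
From HB Require Import structures.
From mathcomp Require Import all_boot all_order all_algebra.
From mathcomp Require Import all_classical all_reals all_analysis.
From mathcomp.multinomials Require mpoly.
Import Order.TTheory GRing.Theory Num.Theory.
Import numFieldNormedType.Exports.

Set Implicit Arguments.
Unset Strict Implicit.
Unset Printing Implicit Defensive.

Local Open Scope classical_set_scope.
Local Open Scope ring_scope.

Section TupleCons.
Context (R : realType) (n : nat).
Local Notation RR := (measurableTypeR R).
Variable mu : {sigma_finite_measure set (n.-tuple RR) -> \bar R}.

Definition tuple_cons (u : RR * n.-tuple RR) : n.+1.-tuple RR :=
  [tuple of u.1 :: u.2].

Lemma measurable_tuple_cons : measurable_fun setT tuple_cons.
Proof. exact: measurable_cons. Qed.

Definition cons_measure : set (n.+1.-tuple RR) -> \bar R :=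
  pushforward (@lebesgue_measure R \x mu)%E tuple_cons.


Definition cons_measure_measure : {measure set (n.+1.-tuple RR) -> \bar R} :=
  measure_function_pushforward__canonical__measure_function_Measure
    (@lebesgue_measure R \x mu)%E measurable_tuple_cons.

HB.instance Definition _ := Measure.copy cons_measure cons_measure_measure.

Let cons_measure_sigma_finite : sigma_finite setT cons_measure.
Proof.
have /sigma_finiteP[F [TF ndF Foo]] := sigma_finiteT (@lebesgue_measure R).
have /sigma_finiteP[G [TG ndG Goo]] := sigma_finiteT mu.
pose uncons (t : n.+1.-tuple RR) : RR * n.-tuple RR :=
  (thead t, [tuple of behead t]).
have unconsK : cancel tuple_cons uncons.
  move=> [x t]; congr (_, _); exact/val_inj.
have muncons : measurable_fun setT uncons.
  apply/measurable_fun_pairP; split; last exact: measurable_behead.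
  exact: measurable_tnth.
exists (fun i => uncons @^-1` (F i `*` G i)) => [|i].
  apply/seteqP; split=> // t _.
  have [j _ Fj] : (\bigcup_i F i) (uncons t).1 by rewrite -TF.
  have [k _ Gk] : (\bigcup_i G i) (uncons t).2 by rewrite -TG.
  exists (maxn j k) => //; split.
    by move: Fj; exact/subsetPset/ndF/leq_maxl.
  by move: Gk; exact/subsetPset/ndG/leq_maxr.
have [mFi Fioo] := Foo i; have [mGi Gioo] := Goo i; split.
  by rewrite -[X in measurable X]setTI; apply: muncons => //; exact: measurableX.
rewrite /cons_measure /pushforward -comp_preimage.
rewrite (_ : uncons \o tuple_cons = id) ?preimage_id; last exact/funext.
by rewrite product_measure1E// lte_mul_pinfty// ge0_fin_numE.
Qed.

HB.instance Definition _ := Measure_isSigmaFinite.Build _ _ _ cons_measure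
  cons_measure_sigma_finite.
End TupleCons.

(* Lebesgue measure on R^n, as an iterated product measure on n-tuples. *)
Fixpoint lebesgue_tuple (R : realType) (n : nat) :
    {sigma_finite_measure set (n.-tuple (measurableTypeR R)) -> \bar R} :=
  match n with
  | 0 => \d_([tuple] : 0.-tuple (measurableTypeR R))
  | m.+1 => cons_measure (lebesgue_tuple R m)
  end.

(* The notations of mpoly clash with those of mathcomp-analysis. *)
Export -(notations) mpoly.

(* [msize p] is 1 + the total degree of [p], and 0 for the zero polynomial. *)
Notation msize p := (mmeasure mdeg p).

Section Integrals.
Context (R : realType) (d : nat).

Definition row_of_tuple n (t : n.-tuple R) : 'rV[R]_n := \row_i tnth t i.

Definition dot n (u v : 'rV[R]_n) : R := \sum_i u 0 i * v 0 i.

Definition peval (p : mpoly d R) (x : 'rV[R]_d) : R :=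
  meval (fun i => x 0 i) p.

Definition grad (p : mpoly d R) (x : 'rV[R]_d) : 'rV[R]_d :=
  \row_i peval (mderiv i p) x.

Definition int_vol (D : set 'rV[R]_d) (g : 'rV[R]_d -> R) : R :=
  \int[lebesgue_tuple R d]_(t in @row_of_tuple d @^-1` D) g (row_of_tuple t).

Definition integrable_vol (D : set 'rV[R]_d) (g : 'rV[R]_d -> R) : Prop :=
  (lebesgue_tuple R d).-integrable (@row_of_tuple d @^-1` D)
    (fun t => (g (row_of_tuple t))%:E).

Definition ref_simplex n : set (n.-tuple R) :=
  [set t | (forall i, 0 <= tnth t i) /\ \sum_i tnth t i <= 1].

Variables (V : finType) (pt : V -> 'rV[R]_d).

Definition vertex (e : {set V}) (i : nat) : 'rV[R]_d :=
  nth 0 [seq pt v | v <- enum e] i.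

Definition face_edges (e : {set V}) : 'M[R]_(d.-1, d) :=
  \matrix_(i < d.-1) (vertex e i.+1 - vertex e 0).

(* Affine parametrization of the face with the d vertices in [e] by the
   reference simplex of R^(d-1); its surface element is the square root of the
   Gram determinant of the edge vectors. *)
Definition face_param (e : {set V}) (t : d.-1.-tuple R) : 'rV[R]_d :=
  vertex e 0 + row_of_tuple t *m face_edges e.

Definition int_face (e : {set V}) (g : 'rV[R]_d -> R) : R :=
  Num.sqrt (\det (face_edges e *m (face_edges e)^T)) *
  \int[lebesgue_tuple R d.-1]_(t in @ref_simplex d.-1) g (face_param e t).

Definition integrable_face (e : {set V}) (g : 'rV[R]_d -> R) : Prop :=
  (lebesgue_tuple R d.-1).-integrable (@ref_simplex d.-1)
    (fun t => (g (face_param e t))%:E).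

End Integrals.

Section Mesh.
Context (R : realType) (d : nat) (V : finType) (pt : V -> 'rV[R]_d).
Implicit Types (s e T : {set V}) (Omega : set 'rV[R]_d).

Definition hull s : set 'rV[R]_d :=
  [set x | exists w : V -> R,
    [/\ forall v, v \in s -> 0 <= w v, \sum_(v in s) w v = 1
      & x = \sum_(v in s) w v *: pt v]].

Definition relint s : set 'rV[R]_d :=
  [set x | exists w : V -> R,
    [/\ forall v, v \in s -> 0 < w v, \sum_(v in s) w v = 1
      & x = \sum_(v in s) w v *: pt v]].

Definition affinely_independent s : Prop :=
  forall w : V -> R, \sum_(v in s) w v = 0 ->
    \sum_(v in s) w v *: pt v = 0 -> forall v, v \in s -> w v = 0.

Definition is_simplex T : Prop := #|T| = d.+1 /\ affinely_independent T.

Definition topological_boundary Omega : set 'rV[R]_d :=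
  closure Omega `\` interior Omega.

(* A simplex is given by its set of vertices, so that the common face of two
   elements [T] and [T'] is spanned by [T :&: T']. *)
Definition conforming_mesh Omega (Th : {set {set V}}) : Prop :=
  [/\ injective pt,
      forall T, T \in Th -> is_simplex T,
      closure Omega = \bigcup_(T in [set` Th]) hull T
    & forall T T', T \in Th -> T' \in Th ->
        hull T `&` hull T' = hull (T :&: T')].

Definition unit_normal e (n : 'rV[R]_d) : Prop :=
  dot n n = 1 /\
  forall v w, v \in e -> w \in e -> dot n (pt v - pt w) = 0.

Definition exterior T e (n : 'rV[R]_d) : bool :=
  [forall v in T :\: e, forall w in e, dot n (pt v - pt w) < 0].

Definition outward_normal T e : 'rV[R]_d :=
  get [set n | unit_normal e n /\ exterior T e n].

End Mesh.

(* The condition that [Omega] is the interior of its closure excludes slits,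
   which would be part of the boundary but interior to the mesh. *)
Definition polyhedral_domain (R : realType) (d : nat) (Omega : set 'rV[R]_d) :
    Prop :=
  [/\ Omega !=set0, open Omega, connected Omega, bounded_set Omega
    & Omega = interior (closure Omega)] /\
  exists (W : finType) (q : W -> 'rV[R]_d) (P : {set {set W}}),
    (forall S, S \in P -> is_simplex q S) /\
    closure Omega = \bigcup_(S in [set` P]) hull q S.

Section Method.
Context (R : realType) (d : nat) (V : finType) (pt : V -> 'rV[R]_d).
Variables (Th : {set {set V}}) (Omega GammaD GammaN : set 'rV[R]_d).
Variables (K : {set V} -> R) (ne : {set V} -> 'rV[R]_d).
Implicit Types (e T : {set V}) (x n : 'rV[R]_d).

Definition faces : {set {set V}} :=
  [set e : {set V} | [exists T in Th, (e \subset T) && (#|e| == d)]]%SET.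

Definition boundary_faces : {set {set V}} :=
  [set e in faces | `[< hull pt e `<=` topological_boundary Omega >]]%SET.

Definition interior_faces : {set {set V}} := faces :\: boundary_faces.

(* Two adjacent closed faces always meet, so a boundary face is assigned to
   one part of a disjoint partition of the boundary through its relative
   interior. *)
Definition faces_on (Gamma : set 'rV[R]_d) : {set {set V}} :=
  [set e in boundary_faces | `[< relint pt e `<=` Gamma >]]%SET.

Definition boundary_partition : Prop :=
  [/\ topological_boundary Omega = GammaD `|` GammaN,
      GammaD `&` GammaN = set0
    & boundary_faces = faces_on GammaD :|: faces_on GammaN].

Definition normal_field : Prop :=
  (forall e, e \in faces -> unit_normal pt e (ne e)) /\
  (forall e T, e \in boundary_faces -> T \in Th -> e \subset T ->
     exterior pt T e (ne e)).

Definition adjacent e : {set {set V}} := [set T in Th | e \subset T]%SET.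

(* A piecewise function is given by one function per element, whence its traces
   on the faces. An interior face has exactly two adjacent elements, and a
   boundary face has exactly one. *)
Definition avg e (v : {set V} -> 'rV[R]_d -> R) x : R :=
  if e \in interior_faces then 2%:R^-1 * \sum_(T in adjacent e) v T x
  else \sum_(T in adjacent e) v T x.

Definition jump e (v : {set V} -> 'rV[R]_d -> R) x : R :=
  if e \in interior_faces then
    \sum_(T in adjacent e) (if exterior pt T e (ne e) then v T x else - v T x)
  else \sum_(T in adjacent e) v T x.

(* Piecewise polynomials; only the values at the elements of [Th] matter. *)
Definition broken := {set V} -> mpoly d R.

Definition trace (q : broken) T x : R := peval (q T) x.

Definition flux (p : broken) n T x : R := K T * dot (grad (p T) x) n.

Definition M0k (k : nat) : set broken :=
  [set w | (forall T, T \in Th -> (msize (w T) <= k.+1)%N) /\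
    exists v : 'rV[R]_d -> R, {within closure Omega, continuous v} /\
      forall T x, T \in Th -> hull pt T x -> v x = peval (w T) x].

Definition M0 : set broken :=
  [set w | exists c : {set V} -> R, forall T, T \in Th -> w T = mpolyC d (c T)].

Definition space_sum (A B : set broken) : set broken :=
  [set w | exists u v, [/\ A u, B v & forall T, T \in Th -> w T = u T + v T]].

(* The barycentric coordinates of [T], indexed by its vertices. *)
Definition barycentric T : {ffun V -> mpoly d R} :=
  xget [ffun=> 0] [set l : {ffun V -> mpoly d R} | forall x,
    \sum_(v in T) peval (l v) x = 1 /\ \sum_(v in T) peval (l v) x *: pt v = x].

(* The face on which the coordinate of the vertex [v] of [T] vanishes is
   [T :\ v]. *)
Definition bubble_coef T (v : V) : R :=
  let l := barycentric T in
  get [set beta : R | int_face pt (T :\ v) (fun x =>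
    beta * K T * dot (grad (l v) x) (outward_normal pt T (T :\ v)) *
    \prod_(w in T :\ v) peval (l w) x ^+ 2) = 1].

(* [beta_v (prod_w lambda_w^2) / lambda_v], with the division carried out. *)
Definition face_bubble T (v : V) : mpoly d R :=
  let l := barycentric T in
  bubble_coef T v *: (l v * \prod_(w in T :\ v) l w ^+ 2).

(* The dimension of the polynomials of degree at most k - 2; it is 0 for
   k = 1, in which case the second sum in [bubble_with] is empty. *)
Definition moment_dim (k : nat) : nat := 'C(k + d - 2, d)%N.

Definition is_basis (k : nat) (psi : 'I_(moment_dim k) -> mpoly d R) : Prop :=
  (forall j, (msize (psi j) <= k.-1)%N) /\
  (forall p : mpoly d R, (msize p <= k.-1)%N ->
     exists! c : 'rV[R]_(moment_dim k), p = \sum_j c 0 j *: psi j).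

Section Bubbles.
Variables (k : nat) (psi : {set V} -> 'I_(moment_dim k) -> mpoly d R).

Definition bubble_with T (gamma : 'rV[R]_(moment_dim k)) : mpoly d R :=
  \sum_(v in T) face_bubble T v +
  \sum_j gamma 0 j *: (\prod_(w in T) barycentric T w ^+ 2 * psi T j).

Definition bubble_moments T : 'rV[R]_(moment_dim k) :=
  xget 0 [set gamma | forall i, int_vol (hull pt T)
    (fun x => K T * peval (bubble_with T gamma) x * peval (psi T i) x) = 0].

Definition bubble T : mpoly d R := bubble_with T (bubble_moments T).

Definition Mb : set broken :=
  [set w | exists alpha : {set V} -> R, forall T', T' \in Th ->
    w T' = \sum_(T in Th) alpha T *: (if T' == T then bubble T else 0)].

Definition trial_space : set broken := space_sum (M0k k) Mb.

Definition test_space : set broken := space_sum (M0k k) M0.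

End Bubbles.

Definition bilinear_form (p q : broken) : R :=
  \sum_(T in Th) int_vol (hull pt T)
    (fun x => K T * dot (grad (p T) x) (grad (q T) x))
  - \sum_(e in interior_faces :|: faces_on GammaD)
      int_face pt e (fun x => avg e (flux p (ne e)) x * jump e (trace q) x)
  - \sum_(e in interior_faces :|: faces_on GammaD)
      int_face pt e (fun x => avg e (flux q (ne e)) x * jump e (trace p) x).

(* On a boundary face, [avg] is the trace from the only adjacent element. *)
Definition linear_form (f pD gN : 'rV[R]_d -> R) (q : broken) : R :=
  \sum_(T in Th) int_vol (hull pt T) (fun x => f x * peval (q T) x)
  - \sum_(e in faces_on GammaN)
      int_face pt e (fun x => gN x * avg e (trace q) x)
  - \sum_(e in faces_on GammaD)
      int_face pt e (fun x => avg e (flux q (ne e)) x * pD x).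

(* The normal component, with respect to the outward normal of [T], of the
   recovered velocity on the face [e] of [T]; the last case is that of a face
   on [GammaD]. *)
Definition normal_velocity (gN : 'rV[R]_d -> R) (p : broken) T e x : R :=
  let n := outward_normal pt T e in
  if e \in faces_on GammaN then gN x
  else if e \in interior_faces then - avg e (flux p n) x
  else - flux p n T x.

Definition int_boundary T (u : {set V} -> 'rV[R]_d -> R) : R :=
  \sum_(v in T) int_face pt (T :\ v) (u (T :\ v)).

End Method.

(* Main.v *)
(**
  Test the scheme with the indicator function of one element [T], a piecewise
  constant. Its gradient vanishes, so only the consistency terms and the source
  survive, and on each facet of [T] the jump of the indicator is the sign
  relating the fixed normal of the facet to the outward normal of [T]: what
  remains is the conservation identity. The geometric input is that a facet of a
  simplex has a unique exterior unit normal, equal up to sign to any unit normal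
  of the facet, and that a boundary facet belongs to a single element.
*)
Require Import Defs.
From mathcomp Require Import all_boot all_order all_algebra.
From mathcomp Require Import all_classical all_reals all_analysis.
Import Order.TTheory GRing.Theory Num.Theory.
Import numFieldNormedType.Exports.
Local Open Scope classical_set_scope.
Local Open Scope ring_scope.


(** * The Euclidean inner product on row vectors *)

Section Dot.
Context {R : realType} {n : nat}.
Implicit Types u v w : 'rV[R]_n.
Set Implicit Arguments.

Lemma dotE u v : dot u v = (u *m v^T) 0 0.
Proof. by rewrite mxE; apply: eq_bigr => i _; rewrite !mxE. Qed.

Lemma dotC u v : dot u v = dot v u.
Proof. by apply: eq_bigr => i _; rewrite mulrC. Qed.

Lemma dotDr u v w : dot u (v + w) = dot u v + dot u w.
Proof. by rewrite !dotE linearD mulmxDr mxE. Qed.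

Lemma dotNr u v : dot u (- v) = - dot u v.
Proof. by rewrite !dotE linearN mulmxN mxE. Qed.

Lemma dotNl u v : dot (- u) v = - dot u v.
Proof. by rewrite dotC dotNr dotC. Qed.

Lemma dotZr u v a : dot u (a *: v) = a * dot u v.
Proof. by rewrite !dotE linearZ -scalemxAr mxE. Qed.

Lemma dot0l u : dot 0 u = 0.
Proof. by rewrite dotE mul0mx mxE. Qed.

Lemma dot0r u : dot u 0 = 0.
Proof. by rewrite dotC dot0l. Qed.

Lemma dotBZr u v w a b :
  dot u (a *: v - b *: w) = a * dot u v - b * dot u w.
Proof. by rewrite dotDr dotNr !dotZr. Qed.

Lemma dot_sumr (I : finType) (A : {set I}) u (F : I -> 'rV[R]_n) :
  dot u (\sum_(i in A) F i) = \sum_(i in A) dot u (F i).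
Proof.
by elim/big_rec2: _ => [|i x y _ <-]; rewrite ?dot0r// dotDr.
Qed.

Lemma dot_eq0 u : dot u u = 0 -> u = 0.
Proof.
move=> /eqP; rewrite /dot psumr_eq0 => [/allP u0|i _]; last first.
  by rewrite -expr2 sqr_ge0.
apply/rowP => i; rewrite mxE; apply/eqP.
by have := u0 i (mem_index_enum i); rewrite /= -expr2 sqrf_eq0.
Qed.

(** Since the weights have total 1, [y] equals [\sum_(i in A) m i *: y] and can be moved under the
    sum. Heights over a hyperplane are computed this way below. *)
Lemma dot_affine (I : finType) (A : {set I}) (F : I -> 'rV[R]_n) (m : I -> R)
    u y : \sum_(i in A) m i = 1 ->
  dot u (\sum_(i in A) m i *: F i - y) = \sum_(i in A) m i * dot u (F i - y).
Proof.
move=> m1; rewrite -[X in _ - X]scale1r -m1 scaler_suml -sumrB dot_sumr.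
by apply: eq_bigr => i _; rewrite -scalerBr dotZr.
Qed.

End Dot.

(** * Signs and zeros of the volume and face integrals *)

Section Integrals.
Context {R : realType}.
Set Implicit Arguments.

(* [fine] maps both infinities to 0, which settles the non-integrable case. *)
Lemma RintegralN d' (T : measurableType d') (mu : {measure set T -> \bar R})
    (D : set T) (g : T -> R) :
  \int[mu]_(x in D) (- g x) = - \int[mu]_(x in D) g x.
Proof.
rewrite /Rintegral; under eq_integral do rewrite EFinN.
rewrite integralE [in RHS]integralE funeposN funenegN.
by do 2 case: integral => [?| |] //=; rewrite ?oppr0// opprB.
Qed.

Context {d : nat} {V : finType}.
Context (pt : V -> 'rV[R]_d).

Lemma int_faceN (e : {set V}) (g : 'rV[R]_d -> R) :
  int_face pt e (fun x => - g x) = - int_face pt e g.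
Proof. by rewrite /int_face RintegralN mulrN. Qed.

Lemma int_face0 (e : {set V}) : int_face pt e (fun=> 0) = 0.
Proof. by rewrite /int_face /Rintegral integral0 mulr0. Qed.

Lemma int_vol0 (D : set 'rV[R]_d) : int_vol D (fun=> 0) = 0.
Proof. by rewrite /int_vol /Rintegral integral0. Qed.

End Integrals.

(** * Facets of a simplex and their exterior normals *)

Section Simplex.
Context {R : realType} {d : nat} {V : finType} {pt : V -> 'rV[R]_d}.
Implicit Types (e T : {set V}) (v w : V) (n m : 'rV[R]_d).
Set Implicit Arguments.

(** In homogeneous coordinates the vertices are the rows [(1, pt v)] of a matrix with [d.+1] rows
    and columns. Affine independence makes the rows free, hence spanning, and the coefficients of
    [(1, x)] are the weights. *)
Lemma simplex_affine_span T (x : 'rV[R]_d) : is_simplex pt T ->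
  exists2 mu : V -> R, \sum_(v in T) mu v = 1 & \sum_(v in T) mu v *: pt v = x.
Proof.
move=> [cT indT].
have /card_gt0P[v0 v0T] : (0 < #|T|)%N by rewrite cT.
pose rk := enum_rank_in v0T.
have sumE (M : nmodType) (F : V -> M) :
    \sum_(v in T) F v = \sum_(i < #|T|) F (enum_val i) by exact: big_enum_val.
pose A : 'M[R]_(#|T|, 1 + d) :=
  \matrix_(i < #|T|) row_mx (1%:M : 'M[R]_1) (pt (enum_val i)).
have mulA (u : 'rV[R]_#|T|) : u *m A =
    row_mx (\sum_(v in T) u 0 (rk v))%:M (\sum_(v in T) u 0 (rk v) *: pt v).
  rewrite 2!sumE mulmx_sum_row -[LHS]hsubmxK; congr row_mx.
    apply/rowP => j; rewrite !ord1 !mxE summxE; apply: eq_bigr => i _.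
    by rewrite !mxE /= /rk enum_valK_in (unsplitK (inl 0)) mxE mulr1.
  apply/rowP => j; rewrite !mxE !summxE; apply: eq_bigr => i _.
  by rewrite !mxE /= /rk enum_valK_in (unsplitK (inr j)).
have fullA : row_full A.
  have : row_free A.
    apply: inj_row_free => u; rewrite mulA -row_mx0 => /eq_row_mx[].
    move=> /rowP/(_ 0); rewrite !mxE eqxx => s0 p0.
    apply/rowP => i; have := indT _ s0 p0 (enum_val i) (enum_valP i).
    by rewrite /rk enum_valK_in mxE.
  (* The matrix is square, so free rows already have full rank. *)
  by rewrite /row_free /row_full => /eqP ->; rewrite cT.
have /submxP[D] : (row_mx (1%:M : 'M[R]_1) x <= A)%MS by exact: submx_full.
rewrite mulA => /eq_row_mx[/rowP/(_ 0)]; rewrite !mxE eqxx => s1 px.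
by exists (fun v => D 0 (rk v)).
Qed.

(** Writing the point [n + pt v] as an affine combination of the vertices turns the hypothesis into
    [dot n n = 0]. *)
Lemma simplex_orthogonal T v n : is_simplex pt T ->
  (forall w, w \in T -> dot n (pt w - pt v) = 0) -> n = 0.
Proof.
move=> sT nT; have [mu mu1 mun] := simplex_affine_span (n + pt v) sT.
apply: dot_eq0; rewrite -[X in dot _ X](addrK (pt v)) -mun dot_affine//.
by rewrite big1// => w wT; rewrite nT// mulr0.
Qed.

Lemma facetP T e : e \subset T -> #|T| = #|e|.+1 ->
  exists2 v, v \in T & e = T :\ v.
Proof.
move=> eT cT; have /cards1P[v Tev] : #|T :\: e| == 1%N.
  by rewrite cardsDS// cT subSnn.
have : v \in T :\: e by rewrite Tev set11.
rewrite inE => /andP[_ vT]; exists v => //.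
by rewrite -Tev finset.setDDr finset.setDv finset.set0U; apply/esym/finset.setIidPr.
Qed.

(** The only vertex of [T] off the facet is [v], so the outer quantifier of [exterior] collapses. *)
Lemma exteriorP T v n : v \in T ->
  reflect (forall w, w \in T :\ v -> dot n (pt v - pt w) < 0)
          (exterior pt T (T :\ v) n).
Proof.
move=> vT; have -> : exterior pt T (T :\ v) n =
    [forall w in T :\ v, dot n (pt v - pt w) < 0].
  apply/forall_inP/idP => [/(_ v)|h u].
    by rewrite !inE eqxx vT; apply.
  by rewrite !inE negb_and negbK => /andP[/orP[/eqP->|/negPf->]//].
exact: forall_inP.
Qed.

Lemma unit_normalN e n : unit_normal pt e n -> unit_normal pt e (- n).
Proof.
move=> [n1 ne]; split=> [|v w ve we]; first by rewrite dotNl dotNr opprK.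
by rewrite dotNl ne// oppr0.
Qed.

Lemma facet_orthogonal T v w n : is_simplex pt T -> w \in T :\ v ->
  (forall u, u \in T :\ v -> dot n (pt u - pt w) = 0) ->
  dot n (pt v - pt w) = 0 -> n = 0.
Proof.
move=> sT we ne nv; apply: (simplex_orthogonal (v := w) sT) => u uT.
by have [->//|uv] := eqVneq u v; apply: ne; rewrite !inE uv.
Qed.

(** The two base points differ by a vector of the facet, orthogonal to [n]. Hence the sign test of
    [exterior] can be made at a single vertex of the facet. *)
Lemma facet_height T v n w u : unit_normal pt (T :\ v) n ->
  w \in T :\ v -> u \in T :\ v ->
  dot n (pt v - pt w) = dot n (pt v - pt u).
Proof.
move=> [_ ne] we ue.
by rewrite -(subrKA (pt u) (pt v) (- pt w)) [LHS]dotDr (ne u w)// addr0.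
Qed.

(** The height of [v] over the facet is nonzero, since otherwise [n] would be orthogonal to the
    whole simplex and vanish. It is the same from every base point, so if it is not negative, it is
    positive, and reversing [n] makes it negative. *)
Lemma exteriorN T v n : (0 < d)%N -> is_simplex pt T -> v \in T ->
  unit_normal pt (T :\ v) n ->
  ~~ exterior pt T (T :\ v) n -> exterior pt T (T :\ v) (- n).
Proof.
move=> d0 sT vT un; have [n1 ne] := un.
move=> /(exteriorP _ vT) Next; apply/(exteriorP _ vT) => w we.
rewrite dotNl oppr_lt0 lt_neqAle eq_sym; apply/andP; split.
  apply/eqP => nv0; have n0 : n = 0.
    by apply: (facet_orthogonal sT we) => // u ue; exact: ne.
  by move: n1; rewrite n0 dot0l => /eqP; rewrite eq_sym oner_eq0.
rewrite leNgt; apply/negP => lt0; apply: Next => u ue.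
by rewrite (facet_height un ue we).
Qed.

Lemma exterior_unit_normal_unique T v n m :
  (0 < d)%N -> is_simplex pt T -> v \in T ->
  unit_normal pt (T :\ v) n -> exterior pt T (T :\ v) n ->
  unit_normal pt (T :\ v) m -> exterior pt T (T :\ v) m -> n = m.
Proof.
move=> d0 sT vT [n1 ne] /(exteriorP _ vT) en [m1 me] /(exteriorP _ vT) em.
have /card_gt0P[w we] : (0 < #|T :\ v|)%N.
  by move: (cardsD1 v T); rewrite vT sT.1 add1n => -[<-].
have {en} := en _ we; have {em} := em _ we.
set a := dot n _; set b := dot m _ => b0 a0.
(* The coefficients are the heights of [v], chosen so that [b *: n - a *: m] is orthogonal to
   [pt v - pt w] as well as to the facet. *)
have abE : b *: n = a *: m.
  apply/eqP; rewrite -subr_eq0; apply/eqP.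
  apply: (facet_orthogonal sT we) => [u ue|].
    by rewrite dotC dotBZr 2!(dotC (pt u - _)) ne// me// !mulr0 subrr.
  by rewrite dotC dotBZr 2!(dotC (pt v - _)) -/a -/b mulrC subrr.
have : b ^+ 2 = a ^+ 2.
  have : dot (b *: n) (b *: n) = dot (a *: m) (a *: m) by rewrite abE.
  by rewrite !dotZr !(dotC (_ *: _)) !dotZr n1 m1 !mulr1 !expr2.
(* Both heights are negative, so equal squares give equal heights after passing to [- a] and
   [- b]. *)
move=> /eqP; rewrite -(sqrrN a) -(sqrrN b) eqrXn2// ?oppr_ge0 ?ltW//.
rewrite eqr_opp => /eqP ba; move: abE; rewrite ba => /scalerI; apply.
by rewrite lt_eqF.
Qed.

(** Existence and uniqueness of the exterior unit normal determine the choice made by [get]; the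
    outward normal can thus be compared with the fixed normal of the face. *)
Lemma outward_normalE T v n : (0 < d)%N -> is_simplex pt T -> v \in T ->
  unit_normal pt (T :\ v) n ->
  outward_normal pt T (T :\ v) = if exterior pt T (T :\ v) n then n else - n.
Proof.
move=> d0 sT vT un; set m := (if _ then _ else _).
have [um em] : unit_normal pt (T :\ v) m /\ exterior pt T (T :\ v) m.
  rewrite /m; case: ifPn => // en.
  by split; [exact: unit_normalN|exact: exteriorN].
apply: get_unique => // m' [um' em'].
exact: exterior_unit_normal_unique um' em' um em.
Qed.

End Simplex.

(** * Faces of the mesh and their adjacent elements *)

Section Mesh.
Context {R : realType} {d : nat} {V : finType} {pt : V -> 'rV[R]_d}.
Context {Th : {set {set V}}} {Omega : set 'rV[R]_d} {ne : {set V} -> 'rV[R]_d}.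
Implicit Types (e T : {set V}).
Set Implicit Arguments.
Context (d_gt0 : (0 < d)%N) (mesh : conforming_mesh pt Omega Th).
Context (normals : normal_field pt Th Omega ne).

Lemma mesh_simplex T : T \in Th -> is_simplex pt T.
Proof. by case: mesh => _ + _ _; apply. Qed.

Lemma facesP e : reflect (exists2 T, T \in Th & e \subset T /\ #|e| = d)
  (e \in faces d Th).
Proof.
rewrite inE; apply: (iffP exists_inP) => -[T TTh].
  by move=> /andP[eT /eqP cE]; exists T.
by move=> [eT cE]; exists T => //; rewrite eT cE eqxx.
Qed.

Lemma boundary_sub_faces : boundary_faces pt Th Omega \subset faces d Th.
Proof. by apply/fintype.subsetP => e; rewrite inE => /andP[]. Qed.

Lemma faces_on_boundary (G : set 'rV[R]_d) e :
  e \in faces_on pt Th Omega G -> e \in boundary_faces pt Th Omega.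
Proof. by rewrite inE => /andP[]. Qed.

Lemma interior_not_boundary e : e \in interior_faces pt Th Omega ->
  e \notin boundary_faces pt Th Omega.
Proof. by rewrite inE => /andP[]. Qed.

Lemma boundary_not_interior e : e \in boundary_faces pt Th Omega ->
  e \notin interior_faces pt Th Omega.
Proof. by apply: contraTN => /interior_not_boundary. Qed.

Lemma face_card e : e \in faces d Th -> #|e| = d.
Proof. by move=> /facesP[T _ []]. Qed.

Lemma facet_face T v : T \in Th -> v \in T -> T :\ v \in faces d Th.
Proof.
move=> TTh vT; apply/facesP; exists T => //; split; first exact: subD1set.
by have := cardsD1 v T; rewrite vT (mesh_simplex TTh).1 add1n => -[<-].
Qed.

Lemma faces_on_disjoint (G G' : set 'rV[R]_d) e : G `&` G' = set0 ->
  e \in faces_on pt Th Omega G -> e \notin faces_on pt Th Omega G'.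
Proof.
move=> GG'; rewrite inE => /andP[eb /asboolP eG]; apply/negP.
rewrite inE => /andP[_ /asboolP eG'].
have ce := face_card (fintype.subsetP boundary_sub_faces _ eb).
(* The barycentre of the face, a point of its relative interior that would lie in both parts. *)
pose x := \sum_(v in e) d%:R^-1 *: pt v.
have xe : relint pt e x.
  exists (fun=> d%:R^-1); split=> // [v _|]; first by rewrite invr_gt0 ltr0n.
  by rewrite sumr_const ce -[LHS]mulr_natl divff// pnatr_eq0 -lt0n.
have : (G `&` G') x by split; [exact: eG|exact: eG'].
by rewrite GG'.
Qed.

(* If two elements lay on the same side of a common face, a point slightly
   above the barycentre of the face would be in both of them. *)
Lemma boundary_face_adjacent e T T' : e \in boundary_faces pt Th Omega ->
  T \in Th -> T' \in Th -> e \subset T -> e \subset T' -> T = T'.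
Proof.
move=> eb TTh T'Th eT eT'; apply/eqP/negP => /negP TT'.
have ef := fintype.subsetP boundary_sub_faces _ eb.
have ce := face_card ef.
have [_ nn] := normals.1 _ ef; have ext := normals.2 _ _ eb.
have [sT sT'] := (mesh_simplex TTh, mesh_simplex T'Th).
have [v vT eTv] : exists2 v, v \in T & e = T :\ v.
  by apply: facetP; rewrite // sT.1 ce.
have [v' v'T' eTv'] : exists2 v, v \in T' & e = T' :\ v.
  by apply: facetP; rewrite // sT'.1 ce.
(* Distinct elements have [d.+1] vertices each and share at most [d], which [e] already accounts
   for. *)
have TIT' : T :&: T' = e.
  apply/esym/eqP; rewrite eqEcard finset.subsetI eT eT' ce -ltnS -sT.1.
  apply: proper_card; rewrite finset.properEneq finset.subsetIl andbT.
  apply: contraNneq TT' => TI; rewrite eqEcard sT.1 sT'.1 leqnn andbT.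
  by rewrite -TI finset.subsetIr.
have [w we] : exists w, w \in e by apply/card_gt0P; rewrite ce.
set n := ne e in nn ext.
have nv : dot n (pt v - pt w) < 0.
  have := ext T TTh eT; rewrite eTv => /(exteriorP _ vT); apply.
  by rewrite -eTv.
have nv' : dot n (pt v' - pt w) < 0.
  have := ext T' T'Th eT'; rewrite eTv' => /(exteriorP _ v'T'); apply.
  by rewrite -eTv'.
have sumT (M : nmodType) (F : V -> M) :
    \sum_(i in T) F i = F v + \sum_(i in e) F i.
  by rewrite (big_setD1 v)// eTv.
have sumT' (M : nmodType) (F : V -> M) :
    \sum_(i in T') F i = F v' + \sum_(i in e) F i.
  by rewrite (big_setD1 v')// eTv'.
have ne0 (a : V -> R) : \sum_(i in e) a i * dot n (pt i - pt w) = 0.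
  by rewrite big1// => i ie; rewrite nn// mulr0.
(* In affine coordinates of [T'], the height of [v] over [e] is [mu v'] times that of [v']. Both
   heights are negative, so [mu v'] is positive. *)
have [mu mu1 muv] := simplex_affine_span (pt v) sT'.
have mu_gt0 : 0 < mu v'.
  have : dot n (pt v - pt w) = mu v' * dot n (pt v' - pt w).
    by rewrite -{1}muv dot_affine// sumT' ne0 addr0.
  by move=> nvE; move: nv; rewrite nvE nmulr_llt0.
(* Large enough that adding [c] makes every weight [mu i] on the face nonnegative; [eps] below
   normalises the total weight [1 + c *+ d], as [e] has [d] vertices. *)
pose c : R := 1 + \sum_(i in e) `|mu i|.
have c_gt0 : 0 < c by rewrite ltr_pwDl// sumr_ge0.
pose eps : R := (1 + c *+ d)^-1.
have eps_gt0 : 0 < eps by rewrite invr_gt0 ltr_pwDl// mulrn_wge0// ltW.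
have eps1 : eps * (1 + c *+ d) = 1 by rewrite mulVf// gt_eqF// -invr_gt0.
have cmu i : i \in e -> 0 <= mu i + c.
  move=> ie; rewrite -lerBlDl sub0r (le_trans (ler_norm _))// normrN.
  rewrite /c (big_setD1 i)//= addrCA lerDl addr_ge0// sumr_ge0//.
(* The weights of this point in [T] are [a]; expanding [pt v] by [muv] gives its weights [a'] in
   [T']. *)
pose x := eps *: (pt v + c *: \sum_(i in e) pt i).
pose a i := if i == v then eps else eps * c.
pose a' i := eps * (mu i + if i \in e then c else 0).
have vNe : v \notin e by rewrite eTv !inE eqxx.
have v'Ne : v' \notin e by rewrite eTv' !inE eqxx.
have ae i : i \in e -> a i = eps * c.
  by rewrite /a; case: eqP => // -> ve; rewrite ve in vNe.
have a1 : \sum_(i in T) a i = 1.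
  rewrite sumT (eq_bigr _ ae) sumr_const ce /a eqxx.
  by rewrite -mulrnAr -{1}[eps]mulr1 -mulrDr.
have ax : x = \sum_(i in T) a i *: pt i.
  rewrite sumT {1}/a eqxx /x scalerDr scalerA scaler_sumr; congr (_ + _).
  by apply: eq_bigr => i ie; rewrite ae.
have xT : hull pt T x.
  exists a; split=> // i _; rewrite /a; case: ifP => _; rewrite ltW//.
  exact: mulr_gt0.
have xT' : hull pt T' x.
  exists a'; split=> [i iT'||].
  - rewrite /a' pmulr_rge0//; case: ifPn => [/cmu//|]; rewrite addr0.
    by rewrite eTv' !inE iT' andbT negbK => /eqP ->; rewrite ltW.
  - rewrite -mulr_sumr big_split/= mu1 sumT' (negPf v'Ne) add0r.
    rewrite -big_mkcondr/= (eq_bigl (mem e)) => [|i]; last by rewrite andbb.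
    by rewrite sumr_const ce.
  - rewrite /a' /x; under [RHS]eq_bigr do rewrite -scalerA scalerDl.
    rewrite -scaler_sumr big_split/= muv sumT' (negPf v'Ne) scale0r add0r.
    by rewrite scaler_sumr; congr (_ *: (_ + _)); apply: eq_bigr => i ->.
(* Conformity forces [x] into the face, at height 0, whereas its weights in [T] give it [eps] times
   the nonzero height of [v]. *)
have [b [_ b1 bx]] : hull pt e x.
  by rewrite -TIT'; case: mesh => _ _ _ <-.
have : dot n (x - pt w) = 0 by rewrite bx dot_affine.
rewrite ax dot_affine// sumT ne0 addr0 /a eqxx => /eqP.
by rewrite mulf_eq0 gt_eqF//= lt_eqF.
Qed.

(** Faces outside [T] contribute nothing, and those inside are indexed injectively by the opposite
    vertex. This matches the sums over faces in the forms with the sum in [int_boundary]. *)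
Lemma sum_facets T (S : {set {set V}}) (F : {set V} -> R) : T \in Th ->
  S \subset faces d Th ->
  (forall e, e \in S -> ~~ (e \subset T) -> F e = 0) ->
  \sum_(e in S) F e = \sum_(v in T) if T :\ v \in S then F (T :\ v) else 0.
Proof.
move=> TTh /fintype.subsetP Sf F0; rewrite -big_mkcondr /=.
rewrite (bigID (fun e => e \subset T))/= addrC big1 ?add0r; last first.
  by move=> e /andP[]; exact: F0.
pose A := [set v in T | T :\ v \in S]%SET.
have -> : \sum_(v in T | T :\ v \in S) F (T :\ v) = \sum_(v in A) F (T :\ v).
  by apply: eq_bigl => v; rewrite inE.
rewrite -(@big_imset _ _ _ _ _ (fun v => T :\ v))/=; last first.
  move=> v w; rewrite !inE => /andP[vT _] _ vw.
  apply/eqP; apply: contraT => vNw; have : v \in T :\ w by rewrite !inE vNw.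
  by rewrite -vw !inE eqxx.
apply: eq_bigl => e; apply/andP/imsetP => [[eS eT]|[v + ->]].
  have [v vT eE] : exists2 v, v \in T & e = T :\ v.
    by apply: facetP; rewrite // (mesh_simplex TTh).1 (face_card (Sf _ eS)).
  by exists v; rewrite // inE vT -eE.
by rewrite inE => /andP[vT ->]; rewrite subD1set.
Qed.

Lemma avg_boundary e T (v : {set V} -> 'rV[R]_d -> R) x :
  e \in boundary_faces pt Th Omega -> T \in Th -> e \subset T ->
  avg pt Th Omega e v x = v T x.
Proof.
move=> eb TTh eT; rewrite /avg (negPf (boundary_not_interior eb)).
rewrite (big_pred1 T)// => T'; rewrite inE; apply/andP/eqP => [[T'Th eT']|->//].
exact: boundary_face_adjacent eT' eT.
Qed.

Lemma avg_fluxN e n (K : {set V} -> R) (p : broken R d V) x :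
  avg pt Th Omega e (flux K p (- n)) x = - avg pt Th Omega e (flux K p n) x.
Proof.
have fluxN T : flux K p (- n) T x = - flux K p n T x.
  by rewrite /flux dotNr mulrN.
rewrite /avg; case: ifP => _;
  by rewrite (eq_bigr _ (fun T _ => fluxN T)) sumrN ?mulrN.
Qed.

(** * The indicator of an element as test function in the two forms *)

Definition indicator T : broken R d V := fun T' => mpolyC d (T' == T)%:R.

Lemma trace_indicator T T' x : trace (indicator T) T' x = (T' == T)%:R.
Proof. by rewrite /trace /peval mpoly.mevalC. Qed.

Lemma grad_indicator T T' (x : 'rV[R]_d) : grad (indicator T T') x = 0.
Proof.
apply/rowP => i; rewrite !mxE /indicator mpoly.mderivC /peval.
exact: mpoly.meval0.
Qed.

Lemma indicator_test_space k T : test_space pt Th Omega k (indicator T).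
Proof.
exists (fun=> 0), (indicator T); split=> [| |T' _]; last by rewrite add0r.
  split=> [T' _|]; first by rewrite mpoly.msize0.
  exists (fun=> 0); split; first exact: cst_continuous.
  by move=> T' x _ _; rewrite /peval mpoly.meval0.
by exists (fun T' => (T' == T)%:R).
Qed.

Lemma avg_flux_indicator e n (K : {set V} -> R) T x :
  avg pt Th Omega e (flux K (indicator T) n) x = 0.
Proof.
have flux0 T' : flux K (indicator T) n T' x = 0.
  by rewrite /flux grad_indicator dot0l mulr0.
by rewrite /avg; case: ifP => _; rewrite big1 ?mulr0.
Qed.

(** Only the trace from [T] is nonzero, and it enters with the sign that tells on which side of the
    fixed normal [T] lies. *)
Lemma jump_indicator e T x : T \in Th ->
  jump pt Th Omega ne e (trace (indicator T)) x =
  if e \subset T then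
    if (e \in interior_faces pt Th Omega) && ~~ exterior pt T e (ne e) then -1
    else 1
  else 0.
Proof.
move=> TTh; rewrite /jump; have [eT|eT] := boolP (e \subset T); last first.
  have T'0 T' : T' \in Defs.adjacent Th e -> trace (indicator T) T' x = 0.
    rewrite inE trace_indicator => /andP[_ eT'].
    by case: eqP => // T'T; rewrite -T'T eT' in eT.
  case: ifP => _; rewrite big1// => T' /T'0 ->.
  by case: ifP; rewrite ?oppr0.
have Ta : T \in Defs.adjacent Th e by rewrite inE TTh.
have T'0 T' : T' != T -> trace (indicator T) T' x = 0.
  by rewrite trace_indicator => /negPf ->.
case: ifP => _ /=; rewrite (bigD1 T Ta)/= trace_indicator eqxx big1 ?addr0//.
- by case: ifP.
- by move=> T' /andP[_ /T'0 ->]; case: ifP; rewrite ?oppr0.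
- by move=> T' /andP[_ /T'0 ->].
Qed.

(** The zero gradient removes the volume term and the second face term; the jump confines the first
    face term to the facets of [T]. *)
Lemma bilinear_form_indicator (GammaD : set 'rV[R]_d) K p T : T \in Th ->
  bilinear_form pt Th Omega GammaD K ne p (indicator T) =
  - \sum_(v in T) (if T :\ v \in interior_faces pt Th Omega :|:
                                    faces_on pt Th Omega GammaD
     then int_face pt (T :\ v) (fun x =>
       avg pt Th Omega (T :\ v) (flux K p (ne (T :\ v))) x *
       jump pt Th Omega ne (T :\ v) (trace (indicator T)) x)
     else 0).
Proof.
move=> TTh; rewrite /bilinear_form.
rewrite [X in X - _ - _]big1 ?sub0r; last first.
  move=> T' _; rewrite -[RHS](int_vol0 (hull pt T')); congr int_vol.
  by apply/funext => x; rewrite grad_indicator dot0r mulr0.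
rewrite [X in _ - X]big1 ?subr0; last first.
  move=> e _; rewrite -[RHS](int_face0 pt e); congr int_face.
  by apply/funext => x; rewrite avg_flux_indicator mul0r.
rewrite (sum_facets _ TTh)//.
  apply/fintype.subsetP => e; rewrite inE => /orP[|/faces_on_boundary].
    by rewrite inE => /andP[].
  exact: (fintype.subsetP boundary_sub_faces).
move=> e _ eT; rewrite -[RHS](int_face0 pt e); congr int_face.
by apply/funext => x; rewrite jump_indicator// (negPf eT) mulr0.
Qed.

Lemma linear_form_indicator (GammaD GammaN : set 'rV[R]_d) K f pD gN T :
  T \in Th ->
  linear_form pt Th Omega GammaD GammaN K ne f pD gN (indicator T) =
  int_vol (hull pt T) f -
  \sum_(v in T) (if T :\ v \in faces_on pt Th Omega GammaN
                 then int_face pt (T :\ v) gN else 0).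
Proof.
move=> TTh; rewrite /linear_form.
rewrite [X in _ - X]big1 ?subr0; last first.
  move=> e _; rewrite -[RHS](int_face0 pt e); congr int_face.
  by apply/funext => x; rewrite avg_flux_indicator mul0r.
congr (_ - _).
  rewrite (big_setD1 T)//= [X in _ + X]big1 ?addr0; last first.
    move=> T'; rewrite !inE => /andP[/negPf T'T _].
    rewrite -[RHS](int_vol0 (hull pt T')); congr int_vol.
    apply/funext => x; rewrite -[peval _ _]/(trace (indicator T) T' x).
    by rewrite trace_indicator T'T mulr0.
  congr int_vol; apply/funext => x.
  rewrite -[peval _ _]/(trace (indicator T) T x).
  by rewrite trace_indicator eqxx mulr1.
have subf : faces_on pt Th Omega GammaN \subset faces d Th.
  apply/fintype.subsetP => e /faces_on_boundary.
  exact: (fintype.subsetP boundary_sub_faces).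
rewrite (sum_facets _ TTh)//.
  apply: eq_bigr => v vT; case: ifP => // /faces_on_boundary eb.
  congr int_face; apply/funext => x.
  by rewrite (avg_boundary _ _ eb TTh) ?subD1set// trace_indicator eqxx mulr1.
move=> e eN eT; rewrite -[RHS](int_face0 pt e); congr int_face.
(* A Neumann face outside [T] is adjacent only to elements where the indicator vanishes. *)
apply/funext => x; rewrite /avg.
rewrite (negPf (boundary_not_interior (faces_on_boundary eN))).
rewrite big1 ?mulr0// => T'; rewrite inE trace_indicator => /andP[_ eT'].
by case: eqP => // T'T; rewrite -T'T eT' in eT.
Qed.

(** The jump of the indicator is exactly the sign between [ne] and the outward normal, so each
    facet's outflow equals what that facet leaves in the two forms. *)
Lemma int_normal_velocity (GammaD GammaN : set 'rV[R]_d) K p gN T v :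
  boundary_partition pt Th Omega GammaD GammaN -> T \in Th -> v \in T ->
  int_face pt (T :\ v) (normal_velocity pt Th Omega GammaN K gN p T (T :\ v)) =
  (if T :\ v \in faces_on pt Th Omega GammaN then int_face pt (T :\ v) gN
   else 0) -
  (if T :\ v \in interior_faces pt Th Omega :|: faces_on pt Th Omega GammaD
   then int_face pt (T :\ v) (fun x =>
     avg pt Th Omega (T :\ v) (flux K p (ne (T :\ v))) x *
     jump pt Th Omega ne (T :\ v) (trace (indicator T)) x)
   else 0).
Proof.
move=> [_ DN0 bDN] TTh vT; have ef := facet_face TTh vT.
have eT : T :\ v \subset T by exact: subD1set.
have sT := mesh_simplex TTh.
have outE := outward_normalE d_gt0 sT vT (normals.1 _ ef).
set e := T :\ v in ef eT outE *.
have [eN|eN] := boolP (e \in faces_on pt Th Omega GammaN).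
  have eD : e \notin faces_on pt Th Omega GammaD.
    by apply: faces_on_disjoint eN; rewrite setIC.
  have eI := boundary_not_interior (faces_on_boundary eN).
  rewrite finset.in_setU (negPf eI) (negPf eD) subr0; congr int_face.
  by apply/funext => x; rewrite /normal_velocity eN.
(* Every boundary face is on [GammaD] or [GammaN], so a face not on [GammaN] is interior or on
   [GammaD]. *)
have eID : e \in interior_faces pt Th Omega :|: faces_on pt Th Omega GammaD.
  rewrite finset.in_setU finset.in_setD ef andbT orbC -implyNb; apply/implyP => eD.
  by rewrite bDN finset.in_setU negb_or eD.
rewrite eID sub0r -int_faceN; congr int_face; apply/funext => x.
rewrite /normal_velocity (negPf eN) jump_indicator// eT outE.
have [eI|eI] := boolP (e \in interior_faces pt Th Omega).
  by case: ifP => _ /=; rewrite ?avg_fluxN ?mulrN mulr1.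
have eD : e \in faces_on pt Th Omega GammaD.
  by move: eID; rewrite finset.in_setU (negPf eI).
have eb := faces_on_boundary eD.
(* On a boundary face the fixed normal is already exterior, so no sign appears and the average is
   the trace from [T]. *)
by rewrite (normals.2 _ _ eb TTh eT) mulr1 (avg_boundary _ _ eb TTh eT).
Qed.

End Mesh.

(** * Mass balance on an element, summed over its facets *)

Theorem theorem4p2 (R : realType) (d k : nat) (V : finType)
    (pt : V -> 'rV[R]_d) (Th : {set {set V}})
    (Omega GammaD GammaN : set 'rV[R]_d)
    (K : {set V} -> R) (ne : {set V} -> 'rV[R]_d)
    (psi : {set V} -> 'I_(moment_dim d k) -> mpoly d R)
    (f pD gN : 'rV[R]_d -> R) (ph : broken R d V)
    (hd : d = 2%N \/ d = 3%N) (hk : (1 <= k)%N)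
    (hOmega : polyhedral_domain Omega)
    (hTh : conforming_mesh pt Omega Th)
    (hGamma : boundary_partition pt Th Omega GammaD GammaN)
    (hK : exists c C : R, 0 < c /\ forall T, T \in Th -> c <= K T <= C)
    (hne : normal_field pt Th Omega ne)
    (hpsi : forall T, T \in Th -> is_basis (psi T))
    (hf : integrable_vol Omega f)
    (hpD : forall e, e \in faces_on pt Th Omega GammaD ->
             integrable_face pt e pD)
    (hgN : forall e, e \in faces_on pt Th Omega GammaN ->
             integrable_face pt e gN)
    (hph : trial_space pt Th Omega K psi ph)
    (hsol : forall qh : broken R d V, test_space pt Th Omega k qh ->
       bilinear_form pt Th Omega GammaD K ne ph qh =
       linear_form pt Th Omega GammaD GammaN K ne f pD gN qh) :
  forall T, T \in Th ->
    int_boundary pt T (normal_velocity pt Th Omega GammaN K gN ph T) =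
    int_vol (hull pt T) f.
Proof.
move=> T TTh; have d_gt0 : (0 < d)%N by case: hd => ->.
have := hsol _ (indicator_test_space k T).
rewrite bilinear_form_indicator// linear_form_indicator// => /eqP.
(* Solved for the source, the tested equation is the Neumann sum minus the consistency sum, compared
   facet by facet with the outflow. *)
rewrite eq_sym subr_eq addrC => /eqP ->; rewrite -sumrB.
apply: eq_bigr => v vT; exact: int_normal_velocity.
Qed.
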